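(* Let $\{G_i : i\in I\}$ be a collection of profinite groups, each of which has the non-covering property. Then the direct product $\prod_{i\in I}G_i$ has the non-covering property.
   Context: A group $G$ has the non-covering property if for all normal subgroups $M\subsetneq N$ of $G$ of finite index and all $g\in G$, there is $h\in gN$ such that for all $x\in G$, $x^{-1}hx\notin gM$.
   Formalization: The normal subgroups M and N of finite index in the non-covering property are required to be closed (equivalently open), both for the factors and for the product; for arbitrary abstract finite-index subgroups the claim is false for some infinite products of finite groups. *)

(* Defs.v *)
From HB Require Import structures.
From mathcomp Require Import all_boot.
From mathcomp Require Import all_classical.
From mathcomp Require Import topology function_spaces separation_axioms.

Set Implicit Arguments.
Unset Strict Implicit.
Unset Printing Implicit Defensive.

Local Open Scope classical_set_scope.
Local Open Scope group_scope.

HB.mixin Record Topological_Group_isTopologicalGroup G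
    & Topological G & Group G := {
  mulg_continuous : continuous (fun x : G * G => x.1 * x.2) ;
  invg_continuous : continuous (fun x : G => x^-1)
}.

#[short(type="topologicalGroupType")]
HB.structure Definition TopologicalGroup :=
  {G of Topological G & Group G & Topological_Group_isTopologicalGroup G}.

(* A direct product of topological groups carries the product topology and
   the componentwise operations. *)
Section ProductGroup.
Variables (I : Type) (G : I -> topologicalGroupType).
Local Notation P := (prod_topology G).

Definition prod_oneg : P := fun i => 1.
Definition prod_invg (x : P) : P := fun i => (x i)^-1.
Definition prod_mulg (x y : P) : P := fun i => x i * y i.

Fact prod_mulgA : associative prod_mulg.
Proof. by move=> x y z; apply/functional_extensionality_dep => i; exact: mulgA. Qed.
Fact prod_mul1g : left_id prod_oneg prod_mulg.
Proof. by move=> x; apply/functional_extensionality_dep => i; exact: mul1g. Qed.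
Fact prod_mulg1 : right_id prod_oneg prod_mulg.
Proof. by move=> x; apply/functional_extensionality_dep => i; exact: mulg1. Qed.
Fact prod_mulVg : left_inverse prod_oneg prod_invg prod_mulg.
Proof. by move=> x; apply/functional_extensionality_dep => i; exact: mulVg. Qed.
Fact prod_mulgV : right_inverse prod_oneg prod_invg prod_mulg.
Proof. by move=> x; apply/functional_extensionality_dep => i; exact: mulgV. Qed.

HB.instance Definition _ := isGroup.Build P
  prod_mulgA prod_mul1g prod_mulg1 prod_mulVg prod_mulgV.

Fact prod_eval_continuous (i : I) : continuous (fun x : P => x i).
Proof.
move=> x; have /cvg_sup/(_ i) xi : x --> x by exact: cvg_id.
move=> A /(@initial_continuous _ _ (fun f : forall j, G j => f i) x) Ai.
exact: xi Ai.
Qed.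

Fact prod_continuous (T : topologicalType) (f : T -> P) :
  (forall i, continuous (fun x => f x i)) -> continuous f.
Proof.
move=> cf x; apply/cvg_sup => i.
exact: (@continuous_comp_initial _ _ _ (fun g : forall j, G j => g i) f (cf i) x).
Qed.

Fact prod_mulg_continuous : continuous (fun x : P * P => x.1 * x.2).
Proof.
apply: prod_continuous => i x.
apply: (@continuous_comp _ _ _ (fun x : P * P => (x.1 i, x.2 i))
  (fun y : G i * G i => y.1 * y.2)); last exact: mulg_continuous.
apply: cvg_pair.
  apply: (@continuous_comp _ _ _ (fun x : P * P => x.1) (fun y : P => y i)).
    exact: cvg_fst.
  exact: prod_eval_continuous.
apply: (@continuous_comp _ _ _ (fun x : P * P => x.2) (fun y : P => y i)).
  exact: cvg_snd.
exact: prod_eval_continuous.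
Qed.

Fact prod_invg_continuous : continuous (fun x : P => x^-1).
Proof.
apply: prod_continuous => i x.
apply: (@continuous_comp _ _ _ (fun x : P => x i) (fun y : G i => y^-1)).
  exact: prod_eval_continuous.
exact: invg_continuous.
Qed.

HB.instance Definition _ := Topological_Group_isTopologicalGroup.Build P
  prod_mulg_continuous prod_invg_continuous.

End ProductGroup.

Definition profinite (G : topologicalGroupType) :=
  [/\ compact [set: G], hausdorff_space G & totally_disconnected [set: G]].

Definition lcoset_set (G : groupType) (g : G) (H : set G) : set G :=
  [set g * x | x in H].

Definition normal_subgroup (G : groupType) (N : set G) :=
  group_closed (mem N) /\ forall x g : G, N x -> N (x ^ g).

Definition finite_index (G : groupType) (H : set G) :=
  finite_set (range (fun g : G => lcoset_set g H)).

(* Subgroups of a topological group are meant to be closed, as usual for profinite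
   groups, so that a subgroup of finite index is open. For a discrete (abstract)
   group this is no restriction. An infinite product of finite groups may have
   non-closed subgroups of finite index, and those are not considered. *)
Definition non_covering (G : topologicalGroupType) :=
  forall M N : set G,
    normal_subgroup M -> closed M -> finite_index M ->
    normal_subgroup N -> closed N -> finite_index N ->
    M `<` N ->
  forall g : G, exists2 h, lcoset_set g N h
    & forall x : G, ~ lcoset_set g M (x^-1 * h * x).

(* Main.v *)
(* Let M < N in the product G. If some coordinate projection separates N from M,
   the property of that factor suffices. Otherwise N/M commutes with the image in
   G/M of every factor. If gN were contained in the conjugates of gM, each n in N
   would be congruent mod M to a commutator y = [g, x^-1] in N, and every
   coordinate y_i = [g_i, x_i^-1] would be central in the image of G_i in G/M.
   Now [g_i, u] [g_i, v] is congruent to [g_i, uv] when these are central, so the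
   central commutators with g_i form a subgroup Z_i of that image with g_i Z_i
   inside the class of g_i; as G_i has the non-covering property, Z_i is trivial.
   So every y_i lies in M, hence y does since M is closed, and n is in M. *)
From Stdlib Require List.
Require Import Defs.
From mathcomp Require Import all_boot all_classical.
From mathcomp Require Import topology function_spaces.

Set Implicit Arguments.
Unset Strict Implicit.
Unset Printing Implicit Defensive.

Local Open Scope classical_set_scope.
Local Open Scope group_scope.

(** As a rewrite rule this expands commutators and conjugates and cancels inverses, which settles
    the word identities below. *)
Definition groupE :=
  (@conjgE, @commgEl, @invgM, @invgK, @mulgA, @mulgK, @mulgVK, @mulgV, @mulVg,
   @mul1g, @mulg1, @invg1).

(** * Normal subgroups and finite index *)

Section NormalSubgroups.
Variable G : groupType.
Implicit Types (M N : set G).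

Lemma normal_subgroupP N : normal_subgroup N <->
  [/\ N 1, forall x y, N x -> N y -> N (x / y)
    & forall x g, N x -> N (x ^ g)].
Proof.
split=> [[[N1 NB] NJ]|[N1 NB NJ]].
  split=> //; first by rewrite inE in N1.
  by move=> x y /mem_set Nx /mem_set Ny; have := NB _ _ Nx Ny; rewrite inE.
split=> //; split; first by rewrite inE.
by move=> x y; rewrite !inE; exact: NB.
Qed.

Lemma normal1 N : normal_subgroup N -> N 1.
Proof. by case/normal_subgroupP. Qed.

Lemma normalB N x y : normal_subgroup N -> N x -> N y -> N (x / y).
Proof. by case/normal_subgroupP => _ + _; apply. Qed.

Lemma normalV N x : normal_subgroup N -> N x -> N x^-1.
Proof. by move=> nN Nx; rewrite -div1g; apply: normalB => //; exact: normal1. Qed.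

Lemma normalM N x y : normal_subgroup N -> N x -> N y -> N (x * y).
Proof.
by move=> nN Nx Ny; rewrite -(invgK y); apply: normalB => //; exact: normalV.
Qed.

Lemma normalJ N x g : normal_subgroup N -> N x -> N (x ^ g).
Proof. by case/normal_subgroupP => _ _; apply. Qed.

Lemma normalR N x g : normal_subgroup N -> N x -> N [~ x, g].
Proof.
by move=> nN Nx; rewrite commgEl; apply: normalM => //;
  [exact: normalV | exact: normalJ].
Qed.

(** As [M] lies in [N], gN = (gM)N, so the finitely many cosets of [M] map onto those of [N]. *)
Lemma finite_index_sup M N : normal_subgroup M -> normal_subgroup N ->
  M `<=` N -> finite_index M -> finite_index N.
Proof.
move=> nM nN MN fM.
apply: sub_finite_set (finite_image
  (fun F : set G => [set x.1 * x.2 | x in F `*` N]) fM).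
move=> _ [g _ <-]; exists (lcoset_set g M); first by exists g.
apply/seteqP; split=> [x [[_ n] [/= [m Mm <-] Nn] <-]|_ [n Nn <-]].
  by exists (m * n); [apply: normalM => //; exact: MN | rewrite mulgA].
exists (g, n) => //; split=> //; exists 1; first exact: normal1.
by rewrite mulg1.
Qed.

End NormalSubgroups.

(** * Images and preimages under homomorphisms *)

Section Morphism.
Variables (G H : groupType) (f : G -> H) (fM : {morph f : x y / x * y}).

Lemma morph1 : f 1 = 1.
Proof. by apply: (mulgI (f 1)); rewrite -fM !mulg1. Qed.

Lemma morphV : {morph f : x / x^-1}.
Proof. by move=> x; apply: (mulgI (f x)); rewrite -fM !mulgV morph1. Qed.

Lemma morphJ : {morph f : x y / x ^ y}.
Proof. by move=> x y; rewrite !conjgE !fM morphV. Qed.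

Lemma normal_preimage (N : set H) :
  normal_subgroup N -> normal_subgroup (f @^-1` N).
Proof.
move=> nN; apply/normal_subgroupP; split=> [|x y Nx Ny|x g Nx] /=.
- by rewrite morph1; exact: normal1.
- by rewrite fM morphV; exact: normalB.
- by rewrite morphJ; exact: normalJ.
Qed.

Lemma finite_index_preimage (N : set H) :
  finite_index N -> finite_index (f @^-1` N).
Proof.
move=> fN; apply: sub_finite_set (finite_image (fun F => f @^-1` F) fN).
move=> _ [g _ <-]; exists (lcoset_set (f g) N); first by exists (f g).
apply/seteqP; split=> [x [n Nn /= fx]|_ [n Nn <-]] /=; last first.
  by exists (f n); rewrite ?fM.
by exists (g^-1 * x); rewrite ?mulVKg //= fM morphV -fx mulKg.
Qed.

Lemma normal_image (N : set G) : (forall y, exists x, f x = y) ->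
  normal_subgroup N -> normal_subgroup (f @` N).
Proof.
move=> f_surj nN; apply/normal_subgroupP; split.
- by exists 1; [exact: normal1 | exact: morph1].
- move=> _ _ [x Nx <-] [y Ny <-]; exists (x / y); first exact: normalB.
  by rewrite fM morphV.
- move=> _ z [x Nx <-]; have [y <-] := f_surj z.
  by exists (x ^ y); [exact: normalJ | exact: morphJ].
Qed.

Lemma finite_index_image (N : set G) : (forall y, exists x, f x = y) ->
  finite_index N -> finite_index (f @` N).
Proof.
move=> f_surj fN; apply: sub_finite_set (finite_image (fun F => f @` F) fN).
move=> _ [z _ <-]; have [y <-] := f_surj z.
exists (lcoset_set y N); first by exists y.
apply/seteqP; split=> [_ [_ [n Nn <-] <-]|_ [_ [n Nn <-] <-]].
  by exists (f n); [exists n | rewrite fM].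
by exists (y * n); [exists n | rewrite fM].
Qed.

End Morphism.

(** * Commutators that are central modulo a normal subgroup *)

(** For normal [M], the preimage in [G] of the set of central elements of G/M that are commutators
    with the image of [g]. *)
Definition commutator_coset (G : groupType) (M : set G) (g : G) : set G :=
  [set z | (forall w, M [~ z, w]) /\ exists u, M (z^-1 * [~ g, u])].

Lemma commutator_coset_normal (G : groupType) (M : set G) (g : G) :
  normal_subgroup M -> normal_subgroup (commutator_coset M g).
Proof.
move=> nM; apply/normal_subgroupP; split.
- split=> [w|]; first by rewrite comm1g; exact: normal1.
  by exists 1; rewrite commg1 groupE; exact: normal1.
- move=> z z' [Zz [u Mu]] [Zz' [u' Mu']]; split=> [w|].
    have -> : [~ z / z', w] = [~ z, w] ^ z'^-1 * ([~ z', w]^-1) ^ z'^-1.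
      by rewrite !groupE.
    apply: normalM => //; apply: normalJ => //; exact: normalV.
  (* Modulo [M], [g, u'^-1 u] = [g, u] [g, u'^-1]^u and [g, u'^-1] is a conjugate of [g, u']^-1;
     centrality of z' removes the conjugations. *)
  exists (u'^-1 * u).
  have -> : (z / z')^-1 * [~ g, u'^-1 * u] =
      ((z^-1 * [~ g, u]) * ((z'^-1 * [~ g, u'])^-1) ^ (u'^-1 * u)) ^ z'^-1
      * ([~ z', u'^-1 * u]^-1) ^ z'^-1.
    by rewrite !groupE.
  apply: normalM => //; apply: normalJ => //; last exact: normalV.
  by apply: normalM => //; apply: normalJ => //; exact: normalV.
- move=> z h [Zz [u Mu]]; split=> [w|].
    have -> : [~ z ^ h, w] = [~ z, w ^ h^-1] ^ h by rewrite !groupE.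
    exact: normalJ.
  (* Being central modulo [M], [z] agrees with [z ^ h] there, so the same [u] serves. *)
  exists u.
  have -> : (z ^ h)^-1 * [~ g, u] = [~ z, h]^-1 * (z^-1 * [~ g, u]).
    by rewrite !groupE.
  by apply: normalM => //; exact: normalV.
Qed.

(** [N] is a finite union of cosets of [M], each closed as the preimage of [M] under a
    translation. *)
Lemma closed_sup (G : topologicalGroupType) (M N : set G) :
  normal_subgroup M -> normal_subgroup N -> closed M -> finite_index M ->
  M `<=` N -> closed N.
Proof.
move=> nM nN cM fM MN.
pose D := range (fun g : G => lcoset_set g M) `&` [set F | F `<=` N].
have -> : N = \bigcup_(F in D) F.
  apply/seteqP; split=> [x Nx|x [F [_ FN] /FN //]].
  exists (lcoset_set x M); last by exists 1; [exact: normal1|rewrite mulg1].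
  split; first by exists x.
  by move=> _ [m Mm <-]; apply: normalM => //; exact: MN.
apply: closed_bigcup; first by apply: sub_finite_set fM => F [].
move=> _ [[g _ <-] _].
have -> : lcoset_set g M = (fun x => g^-1 * x) @^-1` M.
  apply/seteqP; split=> [_ [m Mm <-]|x Mx] /=; first by rewrite mulKg.
  by exists (g^-1 * x); rewrite ?mulVKg.
apply: closed_comp cM => x _.
apply: (@continuous_comp _ _ _ (fun x : G => (g^-1, x))
  (fun y : G * G => y.1 * y.2)); last exact: mulg_continuous.
by apply: cvg_pair; [exact: cvg_cst | exact: cvg_id].
Qed.

(* If a central element of G/M is a commutator [g, u], then the coset of g by
   the group Z of central commutators [g, u'] lies in the class of g, so the
   non-covering property makes Z trivial. *)
Lemma non_covering_central_commutator (G : topologicalGroupType) (M : set G) :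
  non_covering G -> normal_subgroup M -> closed M -> finite_index M ->
  forall g u : G, (forall w, M [~ [~ g, u], w]) -> M [~ g, u].
Proof.
move=> ncG nM cM fM g u Zgu; apply: contrapT => MNgu.
pose N := commutator_coset M g.
have nN : normal_subgroup N by exact: commutator_coset_normal.
have MN : M `<=` N.
  move=> m Mm; split=> [w|]; first exact: normalR.
  by exists 1; rewrite commg1 mulg1; exact: normalV.
have ltMN : M `<` N.
  split=> // NM; apply: MNgu; apply: NM; split=> //; exists u.
  by rewrite mulVg; exact: normal1.
(* Modulo [M], g z = g [g, v] = g^v, so conjugation by v^-1 brings g z back into gM. *)
have [||_ [z [_ [v Mv]] <-] /(_ v^-1)] := ncG M N nM cM fM nN _ _ ltMN g.
- exact: closed_sup cM fM MN.
- exact: finite_index_sup nM nN MN fM.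
apply; exists ((z^-1 * [~ g, v])^-1 ^ v^-1); last by rewrite !groupE.
by apply: normalJ => //; exact: normalV.
Qed.

(** * Factors and closed subgroups of a direct product *)

Section Product.
Variables (I : Type) (G : I -> topologicalGroupType).
Local Notation P := (prod_topology G).

Definition prod_inj (i : I) (x : G i) : P := fun j =>
  if pselect (i = j) is left e then eq_rect i (fun k => G k) x j e else 1.

Lemma prod_injE i x : prod_inj x i = x.
Proof.
by rewrite /prod_inj; case: pselect => // e; rewrite (Prop_irrelevance e erefl).
Qed.

Lemma prod_inj_neq i j x : i <> j -> @prod_inj i x j = 1.
Proof. by rewrite /prod_inj; case: pselect. Qed.

Lemma prod_injM i : {morph @prod_inj i : x y / x * y}.
Proof.
move=> x y; apply: functional_extensionality_dep => j.
have -> : (prod_inj x * prod_inj y) j = prod_inj x j * prod_inj y j by [].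
have [<-|ij] := pselect (i = j); first by rewrite !prod_injE.
by rewrite !prod_inj_neq // mulg1.
Qed.

Lemma prod_inj_continuous i : continuous (@prod_inj i).
Proof.
apply: prod_continuous => j x.
have [ij|ij] := pselect (i = j).
  case: j / ij; under eq_fun do rewrite prod_injE; exact: cvg_id.
by under eq_fun do rewrite prod_inj_neq//; exact: cvg_cst.
Qed.

(** Elements of one factor commute with all other coordinates of [z]; this gives centrality in the
    theorem. *)
Lemma prod_inj_commg i (x : G i) (z : P) :
  prod_inj [~ z i, x] = [~ z, prod_inj x].
Proof.
apply: functional_extensionality_dep => j.
have -> : [~ z, prod_inj x] j = [~ z j, prod_inj x j] by [].
have [<-|ij] := pselect (i = j); first by rewrite !prod_injE.
by rewrite !prod_inj_neq // commg1.
Qed.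

Lemma nbhs_prod_list (y : P) (U : set P) : nbhs y U ->
  exists s : seq I, forall z : P, (forall i, List.In i s -> z i = y i) -> U z.
Proof.
pose F : set_system P := [set U : set P | exists s : seq I,
  forall z : P, (forall i, List.In i s -> z i = y i) -> U z].
(* Convergence to [y] can be tested one coordinate at a time, where a single index suffices. *)
suff : F --> y by move=> Fy /Fy.
have FF : Filter F.
  split; first by exists [::].
    move=> A B [s sA] [t tB]; exists (s ++ t) => z zy.
    by split; [apply: sA | apply: tB] => i si; apply: zy;
      apply/List.in_app_iff; [left | right].
  by move=> A B AB [s sA]; exists s => z /sA /AB.
apply/cvg_sup => i A /=.
move=> [B [[C oC <-] By] BA].
exists [:: i] => z zy; apply: BA => /=; rewrite zy //; by left.
Qed.

(** Finite products of the components of [y] lie in [M] and approximate [y]. *)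
Lemma closed_prod_mem (M : set P) : normal_subgroup M -> closed M ->
  forall y : P, (forall i, M (prod_inj (y i))) -> M y.
Proof.
move=> nM cM y My; apply: cM => U /nbhs_prod_list[s sU].
(* The third clause serves the induction: a coordinate not yet equal to that of [y] is 1, so one
   multiplication corrects it, even if [s] has repetitions. *)
suff [z [Mz zy _]] : exists z : P, [/\ M z, forall i, List.In i s -> z i = y i
    & forall i, z i = y i \/ z i = 1].
  by exists z; split=> //; exact: sU.
elim: s {sU} => [|i s [z [Mz zs zy]]].
  by exists 1; split=> //; [exact: normal1 | right].
have [ziy|zi1] := zy i.
  by exists z; split=> // j [<- //|]; exact: zs.
exists (z * prod_inj (y i)); split; first exact: normalM.
  move=> j; have -> : (z * prod_inj (y i)) j = z j * prod_inj (y i) j by [].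
  have [<- _|ij [//|sj]] := pselect (i = j).
    by rewrite prod_injE zi1 mul1g.
  by rewrite prod_inj_neq // mulg1; exact: zs.
move=> j; have -> : (z * prod_inj (y i)) j = z j * prod_inj (y i) j by [].
have [<-|ij] := pselect (i = j).
  by left; rewrite prod_injE zi1 mul1g.
by rewrite prod_inj_neq // mulg1; exact: zy.
Qed.

(** By Tychonoff [M] is compact, hence so is its image, which is then closed in the Hausdorff
    factor. *)
Lemma closed_prod_image (i : I) (M : set P) :
  (forall j, compact [set: G j]) -> hausdorff_space (G i) -> closed M ->
  closed ((fun x : P => x i) @` M).
Proof.
move=> cG hG cM; apply: compact_closed => //.
apply: continuous_compact.
  by apply: continuous_subspaceT => x; exact: prod_eval_continuous.
apply: subclosed_compact cM _ (@subsetT _ _).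
have -> : [set: P] = [set f | forall j, [set: G j] (f j)].
  by apply/seteqP; split.
exact: (@tychonoff {classic I} (fun i => G i) (fun=> setT)) cG.
Qed.

End Product.

Theorem theorem1p6 (I : Type) (G : I -> topologicalGroupType)
    (G_profinite : forall i : I, profinite (G i))
    (G_non_covering : forall i : I, non_covering (G i)) :
  non_covering (prod_topology G).
Proof.
move=> M N nM cM fM nN cN fN [MN nNM] g.
have cG i : compact [set: G i] by case: (G_profinite i).
have hG i : hausdorff_space (G i) by case: (G_profinite i).
pose ev i (x : prod_topology G) : G i := x i.
have evM i : {morph ev i : x y / x * y} by [].
have ev_surj i y : exists x, ev i x = y.
  by exists (prod_inj y); exact: prod_injE.
have [[i NMi]|NMi] := pselect (exists i, ~ ev i @` N `<=` ev i @` M).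
  have [||||||| _ [_ [n Nn <-] <-] hx] :=
      @G_non_covering i (ev i @` M) (ev i @` N) _ _ _ _ _ _ _ (g i).
  - exact (normal_image (evM i) (ev_surj i) nM).
  - exact: closed_prod_image cG (hG i) cM.
  - exact (finite_index_image (evM i) (ev_surj i) fM).
  - exact (normal_image (evM i) (ev_surj i) nN).
  - exact: closed_prod_image cG (hG i) cN.
  - exact (finite_index_image (evM i) (ev_surj i) fN).
  - by split=> //; exact: image_subset.
  (* Conjugation is componentwise, so a conjugate of g n in gM would project to one forbidden in
     [G i]. *)
  exists (g * n); first by exists n.
  move=> x [m Mm gm]; apply: (hx (x i)); exists (m i); first by exists m.
  exact: (congr1 (ev i) gm).
have [n Nn nMn] : exists2 n, N n & ~ M n.
  by apply: contrapT => nn; apply: nNM => n Nn; apply: contrapT => Mn;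
    apply: nn; exists n.
exists (g * n); first by exists n.
move=> x [m Mm gm]; apply: nMn.
pose y : prod_topology G := [~ g, x^-1].
have ny : n = y * m ^ x^-1.
  have -> : m = g^-1 * (x^-1 * (g * n) * x) by rewrite -gm mulKg.
  by rewrite /y !groupE.
have Ny : N y.
  have -> : y = n / m ^ x^-1 by rewrite ny mulgK.
  by apply: normalB => //; apply: normalJ => //; exact: MN.
suff My : M y by rewrite ny; apply: normalM => //; exact: normalJ.
apply: closed_prod_mem => // i.
have injM := @prod_injM I G i.
(* By conversion [y i] is the commutator of [g i] with the inverse of [x i]. *)
apply: (@non_covering_central_commutator (G i) (@prod_inj I G i @^-1` M)) => //.
- exact: normal_preimage.
- by apply: closed_comp cM => z _; exact: prod_inj_continuous.
- exact: finite_index_preimage.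
move=> w; change (M (prod_inj [~ y i, w])).
(* No projection separates [N] from [M], so [y i] is also a coordinate of some m' in [M], whose
   commutators lie in [M]. *)
have [m' Mm' <-] : (ev i @` M) (y i).
  by apply: contrapT => nMy; apply: NMi; exists i => NMi; apply/nMy/NMi; exists y.
by rewrite prod_inj_commg; exact: normalR.
Qed.
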